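(* Fix integers $L,R\ge0$ and a bit string $I^0\in\{0,1\}^{\mathbb Z}$, and define $I^1\in\{0,1\}^{\mathbb Z}$ by $I^1(2x)=I^1(2x+1)=I^0(x)$ for all $x\in\mathbb Z$. Let $\mathrm{CA}^0=\mathrm{CA}_{2,L,R,0}$ with initial configuration $\mathrm{CA}^0(\cdot,0)=I^0$ and $\mathrm{CA}^1=\mathrm{CA}_{2,2L,2R,0}$ with initial configuration $\mathrm{CA}^1(\cdot,0)=I^1$. Let $u\in\mathbb Z$, $v\in\mathbb Z_{\ge0}$, $h\in\mathbb Z_{>0}$, let $T_1$ be the play-triangle with base $\{(u-h+1,v),\dots,(u,v)\}$ (i.e. $T_1=T(u,v,h)$), and let $T_2$ be the play-triangle with base $\{(2(u-h)+2,0),\dots,(2u,0)\}$ if $v=0$ (i.e. $T_2=T(2u,0,2h-1)$), and with base $\{(2(u-h)+1,2v-1),\dots,(2u,2v-1)\}$ if $v\ge1$ (i.e. $T_2=T(2u,2v-1,2h)$). Then $T_1$ is $\mathrm{CA}^0$-safe (with parameters $L,R$) if and only if $T_2$ is $\mathrm{CA}^1$-safe (with parameters $2L,2R$).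
   Context: For integers $L,R\ge0$ and initial configuration $\mathrm{CA}(\cdot,0)$, the automaton $\mathrm{CA}_{2,L,R,0}$ is defined for $t\ge1$ by: $\mathrm{CA}(x,t)=0$ if $\mathrm{CA}(x-1,t-1)+\mathrm{CA}(x,t-1)=0$ or $\mathrm{CA}(x-1-L,t-1)+\dots+\mathrm{CA}(x+R,t-1)\ge 2+L+R$ (i.e. all these cells are $1$); otherwise $\mathrm{CA}(x,t)=1$. For $t\ge1$ let $w_1(x,t)$ be the multiset $\{\mathrm{CA}(x-1-L,t-1),\dots,\mathrm{CA}(x+R,t-1)\}$ and $|w_1(x,t)|_0$ its number of zeros. A (right-angle isosceles) play-triangle is $T(x,y,h)=\bigcup_{i=1}^h\{(x-i+1,\,y+h-i),\dots,(x,\,y+h-i)\}$ for $x\in\mathbb Z$, $y\in\mathbb Z_{\ge0}$, $h\ge1$; its base is $\{(x-h+1,y),\dots,(x,y)\}$. A play-triangle $T$ is CA-safe with respect to such an automaton if $\mathrm{CA}(p)=0$ for all $p\in T$ and, when the base is at level $y\ge1$, $|w_1(p)|_0=0$ (i.e. $\le B=0$) for every base cell $p$; when the base is at level $0$ the second condition is vacuous. *)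

(* Defs.v *)
From mathcomp Require Import all_boot all_order all_algebra.
Set Implicit Arguments.
Unset Strict Implicit.
Unset Printing Implicit Defensive.
Import GRing.Theory.
Local Open Scope ring_scope.

(* A cell state is a [bool], with [true] for 1 and [false]
   for 0; sums of states are taken in [nat] through the coercion. *)
Definition config := int -> bool.

(* The states c(x-1-L), ..., c(x+R), listed with multiplicity. *)
Definition window (L R : nat) (c : config) (x : int) : seq bool :=
  [seq c (x - 1 - L%:Z + i%:Z) | i <- iota 0 (2 + L + R)].

Definition ca_step (L R : nat) (c : config) : config := fun x =>
  ~~ (((c (x - 1)%R + c x)%N == 0%N)
      || (2 + L + R <= \sum_(b <- window L R c x) b)%N).

(* The automaton CA_{2,L,R,0} started from [I]; [CA L R I t x] is CA(x,t). *)
Fixpoint CA (L R : nat) (I : config) (t : nat) : config :=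
  if t is t'.+1 then ca_step L R (CA L R I t') else I.

(* Meaningful only for [0 < t]; the multiset is represented by a sequence. *)
Definition w1 (L R : nat) (I : config) (x : int) (t : nat) : seq bool :=
  window L R (CA L R I t.-1) x.

(* The subtraction [y + h - i] in [nat] is never truncated, as [i <= h]. *)
Definition play_triangle (x : int) (y h : nat) (p : int * nat) : Prop :=
  exists2 i : nat, (1 <= i <= h)%N &
    x - i%:Z + 1 <= p.1 <= x /\ p.2 = (y + h - i)%N.

Definition play_base (x : int) (y h : nat) (p : int * nat) : Prop :=
  x - h%:Z + 1 <= p.1 <= x /\ p.2 = y.

Definition ca_safe (L R : nat) (I : config) (x : int) (y h : nat) : Prop :=
  (forall p, play_triangle x y h p -> CA L R I p.2 p.1 = false) /\
  ((1 <= y)%N ->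
   forall p, play_base x y h p -> count_mem false (w1 L R I p.1 p.2) = 0%N).

(* Main.v *)
(** Two steps of the automaton with parameters [2L, 2R] act on doubled
    configurations as one step of the automaton with parameters [L, R].
    If [c] doubles to [d], with successors [c'] and [d'], then
    [d'(2x) = c'(x)], while [d'(2x+1)] is 1 iff [c(x) = 1] and [c] has a zero in
    [x-L, ..., x+R]; in particular [d'(2x+1) = 1] forces [c'(x) = c'(x+1) = 1].
    Hence the configuration after two steps doubles [c'], and the odd cells of
    an intermediate row vanish as soon as the even cell to their right does. *)
Require Import Defs.
From mathcomp Require Import all_boot all_order all_algebra.
From mathcomp Require Import zify.
Import GRing.Theory.
Local Open Scope ring_scope.

Definition full (L R : nat) (c : config) (x : int) : bool :=
  all id (window L R c x).

Lemma fullP (L R : nat) (c : config) (x : int) :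
  reflect (forall y : int, x - 1 - L%:Z <= y <= x + R%:Z -> c y) (full L R c x).
Proof.
rewrite /full /window all_map; apply: (iffP allP) => [H y Hy | H i].
  have := H (absz (y - (x - 1 - L%:Z))%R); rewrite mem_iota /=.
  have -> : x - 1 - L%:Z + (absz (y - (x - 1 - L%:Z))%R)%:Z = y by lia.
  by apply; lia.
by rewrite mem_iota /= => Hi; apply: H; lia.
Qed.

Lemma full_count (L R : nat) (c : config) (x : int) :
  full L R c x <-> count_mem false (window L R c x) = 0%N.
Proof.
rewrite /full -(eq_all (a1 := predC (pred1 false))); last by case.
by rewrite all_predC has_count; split; lia.
Qed.

Lemma ca_stepE (L R : nat) (c : config) (x : int) :
  ca_step L R c x = (c (x - 1) || c x) && ~~ full L R c x.
Proof.
rewrite /ca_step negb_or; congr (_ && ~~ _).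
  by case: (c (x - 1)); case: (c x).
have -> : (2 + L + R)%N = size (window L R c x) by rewrite size_map size_iota.
by rewrite /full all_count eqn_leq count_size -sumn_count sumnE big_map.
Qed.

Definition doubles (c d : config) : Prop :=
  forall x : int, d (2 * x) = c x /\ d (2 * x + 1) = c x.

Lemma int_parity (y : int) : exists x, y = 2 * x \/ y = 2 * x + 1.
Proof. exists (y %/ 2)%Z; lia. Qed.

Section Doubling.
Variables (L R : nat) (c d : config).
Hypothesis cd : doubles c d.

(** The window of [2x] meets exactly the blocks [{2y, 2y+1}] with [y] in the window of [x]; of the
    two end blocks it contains only the inner half. *)
Lemma full_even (x : int) : full (2 * L) (2 * R) d (2 * x) = full L R c x.
Proof.
apply/fullP/fullP => H y Hy.
  by have [dy dy1] := cd y; have [yx|xy] := boolP (y < x);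
    [rewrite -dy1 | rewrite -dy]; apply: H; lia.
have [z [Ez|Ez]] := int_parity y; have [dz dz1] := cd z; subst y.
  by rewrite dz; apply: H; lia.
by rewrite dz1; apply: H; lia.
Qed.

(** Here the window consists of whole blocks, those of [x-L, ..., x+R]; the block of [x-1-L] drops
    out. *)
Lemma full_oddP (x : int) :
  reflect (forall y : int, x - L%:Z <= y <= x + R%:Z -> c y)
          (full (2 * L) (2 * R) d (2 * x + 1)).
Proof.
apply: (iffP (fullP _ _ _ _)) => H y Hy.
  by have [<- _] := cd y; apply: H; lia.
have [z [Ez|Ez]] := int_parity y; have [dz dz1] := cd z; subst y.
  by rewrite dz; apply: H; lia.
by rewrite dz1; apply: H; lia.
Qed.

Let c' := ca_step L R c.
Let d' := ca_step (2 * L) (2 * R) d.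

Lemma step_even (x : int) : d' (2 * x) = c' x.
Proof.
rewrite /d' /c' !ca_stepE full_even (cd x).1.
have -> : 2 * x - 1 = 2 * (x - 1) + 1 by lia.
by rewrite (cd _).2.
Qed.

Lemma step_odd (x : int) :
  d' (2 * x + 1) = c x && ~~ full (2 * L) (2 * R) d (2 * x + 1).
Proof. by rewrite /d' ca_stepE addrK (cd x).1 (cd x).2 orbb. Qed.

(** A zero of [c] in [x-L, ..., x+R] lies in the windows of both [x] and [x+1], and [c x = 1] meets
    the other condition for both. *)
Lemma step_odd_le (x : int) : d' (2 * x + 1) -> c' x && c' (x + 1).
Proof.
rewrite step_odd /c' !ca_stepE addrK => /andP[-> /full_oddP nF] /=.
rewrite orbT /=; apply/andP; split; apply/negP => /fullP F; apply: nF => y Hy;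
  apply: F; lia.
Qed.

(** No window of [d'] is full: it contains some [2z+1] ([z = x-1] for the cell [2x], [z = x] for
    [2x+1]) and all [2y+1] with [y] in [z-L, ..., z+R]. If [d' (2z+1) = 1], some such [y] has
    [c y = 0], so [d' (2y+1) = 0]. *)
Lemma doubles_step2 : doubles c' (ca_step (2 * L) (2 * R) d').
Proof.
move=> x; split; rewrite ca_stepE.
  have E : 2 * x - 1 = 2 * (x - 1) + 1 by lia.
  rewrite step_even E.
  have [c'x|c'x] := boolP (c' x); last first.
    rewrite orbF; apply/negbTE; apply: contra c'x => /andP[/step_odd_le].
    by rewrite subrK => /andP[].
  rewrite orbT /=; apply/negP => /fullP F.
  have := F (2 * (x - 1) + 1); rewrite step_odd => /(_ ltac:(lia)).
  case/andP=> _ /full_oddP; apply=> y Hy.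
  have := F (2 * y + 1); rewrite step_odd => /(_ ltac:(lia)).
  by case/andP.
rewrite addrK step_even.
have [c'x|c'x] := boolP (c' x); last first.
  rewrite /=; apply/negbTE; apply: contra c'x => /andP[/step_odd_le].
  by case/andP.
apply/negP => /fullP F.
have := F (2 * x + 1); rewrite step_odd => /(_ ltac:(lia)).
case/andP=> _ /full_oddP; apply=> y Hy.
have := F (2 * y + 1); rewrite step_odd => /(_ ltac:(lia)).
by case/andP.
Qed.

End Doubling.

Lemma doubles_CA (L R : nat) (I0 I1 : config) (t : nat) :
  doubles I0 I1 -> doubles (CA L R I0 t) (CA (2 * L) (2 * R) I1 (2 * t)).
Proof.
move=> dI; elim: t => [|t IHt]; first by rewrite muln0.
by rewrite mulnS; apply: doubles_step2.
Qed.

(** The equation on [y2 + h2] puts the apex at time [2(v+h-1)], so row [i] of the small triangle,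
    counted from the apex, matches row [2i-1] of the large one. *)
Lemma zeros_doubled (L R : nat) (I0 I1 : config) (u : int) (v h y2 h2 : nat) :
    doubles I0 I1 -> (0 < h)%N -> (y2 + h2 = 2 * (v + h) - 1)%N ->
    (2 * h - 1 <= h2 <= 2 * h)%N ->
  (forall p, play_triangle u v h p -> CA L R I0 p.2 p.1 = false) <->
  (forall p, play_triangle (2 * u) y2 h2 p ->
     CA (2 * L) (2 * R) I1 p.2 p.1 = false).
Proof.
move=> dI hh Ey Eh; have D t := doubles_CA L R I0 I1 t dI.
split=> T [x t] [i Hi /= [Hx Ht]]; last first.
  have [<- _] := D t x; apply: (T (2 * x, (2 * t)%N)).
  by exists (2 * i - 1)%N => /=; lia.
have [s [Et|Et]] : exists s : nat, t = (2 * s)%N \/ t = (2 * s).+1.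
  by exists t./2; lia.
- have [z Ex] := int_parity x; have [e o] := D s z.
  have -> : CA (2 * L) (2 * R) I1 t x = CA L R I0 s z.
    by case: Ex => ->; rewrite Et.
  by apply: (T (z, s)); exists (uphalf i) => /=; lia.
have [z [Ex|Ex]] := int_parity x; rewrite Et Ex /=.
  rewrite (step_even L R _ _ (D s)).
  by apply: (T (z, s.+1)); exists (i./2) => /=; lia.
(* Row [2k] begins at [2(u-k)+1], whose half [u-k] is outside row [k]; the right neighbour [z + 1]
   is always inside. *)
apply: contraFF (T (z + 1, s.+1) _); last by exists (i./2) => /=; lia.
by move/(step_odd_le L R _ _ (D s)) => /andP[].
Qed.

Lemma full_base_doubled (L R : nat) (c d : config) (u : int) (h : nat) :
  doubles c d ->
  (forall x : int, u - h%:Z + 1 <= x <= u -> full L R c x) <->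
  (forall x : int, 2 * u - (2 * h)%N%:Z + 1 <= x <= 2 * u ->
     full (2 * L) (2 * R) d x).
Proof.
move=> cd; split=> B x Hx; last by rewrite -(full_even L R c d cd); apply: B; lia.
have [z [Ez|Ez]] := int_parity x; subst x.
  by rewrite (full_even L R c d cd); apply: B; lia.
apply/(full_oddP L R c d cd) => y Hy.
(* Again [z] may fall just left of the base, but the window of [z + 1] contains [z-L, ..., z+R]. *)
by move/fullP: (B (z + 1) ltac:(lia)); apply; lia.
Qed.

Lemma base_fullE (L R : nat) (I : config) (u : int) (t h : nat) :
  (forall p, play_base u t.+1 h p -> count_mem false (w1 L R I p.1 p.2) = 0%N)
  <-> (forall x : int, u - h%:Z + 1 <= x <= u -> full L R (CA L R I t) x).
Proof.
split=> B => [x Hx|[x s] [/= Hx ->]]; apply/full_count; last exact: B.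
exact: (B (x, t.+1)).
Qed.

Theorem theorem2 (L R : nat) (I0 I1 : config)
    (hI1 : forall x : int, I1 (2 * x) = I0 x /\ I1 (2 * x + 1) = I0 x)
    (u : int) (v h : nat) (hh : (0 < h)%N) :
  ca_safe L R I0 u v h <->
  (if v == 0%N then ca_safe (2 * L) (2 * R) I1 (2 * u) 0 (2 * h - 1)
   else ca_safe (2 * L) (2 * R) I1 (2 * u) (2 * v - 1) (2 * h)).
Proof.
have Z := zeros_doubled L R I0 I1 u v h _ _ hI1 hh.
case: v Z => [|v] Z; rewrite /ca_safe.
  by rewrite (Z 0%N (2 * h - 1)%N) ?add0n //; [split=> -[] | lia..].
have -> : (2 * v.+1 - 1)%N = (2 * v).+1 by lia.
rewrite (Z (2 * v).+1 (2 * h)%N); [|lia..].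
(* The base at level [2v+1] reads its windows at time [2v], where the row doubles the row [v] read
   by the base at level [v+1]. *)
have E := full_base_doubled L R _ _ u h (doubles_CA L R I0 I1 v hI1).
by split=> -[T B]; split=> // _; apply/base_fullE/E/base_fullE; apply: B.
Qed.
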